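(* For all $n \ge 0$ and $k \ge 0$, \[ q_k(\Gamma_n) = \binom{\frac{n+k}{3}}{k} + \binom{\frac{n+k+1}{3}}{k}, \] with the convention $\binom{a}{k}=0$ whenever $a \notin \mathbb{Z}$. Equivalently, writing $m$ for the appropriate integer, $q_k(\Gamma_n) = \binom{m}{k}$ if $n+k = 3m$ or $n+k=3m-1$, and $q_k(\Gamma_n)=0$ if $n+k = 3m+1$.
   Context: For $n\ge 1$, the Fibonacci cube $\Gamma_n$ has as vertices the binary strings of length $n$ with no two consecutive $1$s, adjacent iff they differ in exactly one position; $\Gamma_0$ is a single vertex. $Q_k$ is the $k$-dimensional hypercube ($Q_0$ a single vertex). A cube factor of a graph $G$ is a spanning subgraph whose components are all hypercubes $Q_k$, $k\ge 0$; it is optimal if no cube factor of $G$ has fewer components. For an optimal cube factor $\mathbf F$ of $G$, $q_k(G)$ is the number of components of $\mathbf F$ isomorphic to $Q_k$ ($0$ if none); the paper treats these numbers as determined by $G$. *)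

(* Defs.v *)
From mathcomp Require Import all_boot.

Set Implicit Arguments.
Unset Strict Implicit.
Unset Printing Implicit Defensive.

(* A simple graph is a symmetric irreflexive relation on a finType. *)

Definition differ_once (n : nat) (x y : n.-tuple bool) : bool :=
  #|[set i : 'I_n | tnth x i != tnth y i]| == 1.

Definition hypercube (k : nat) : rel (k.-tuple bool) :=
  fun x y => differ_once x y.

Definition no_consecutive_ones (s : seq bool) : bool :=
  sorted (fun a b => ~~ (a && b)) s.

Definition fib_string (n : nat) : finType :=
  {t : n.-tuple bool | no_consecutive_ones t}.

Definition fib_cube (n : nat) : rel (fib_string n) :=
  fun x y => differ_once (val x) (val y).

Section CubeFactors.
Variable T : finType.
Implicit Types (g f : rel T) (A : {set T}) (k : nat).

Definition spanning_subgraph g f : Prop := symmetric f /\ subrel f g.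

(* Components are represented by their vertex sets. *)
Definition components f : {set {set T}} :=
  [set [set y | connect f x y] | x : T].

(* The subgraph of f induced on A is isomorphic to Q_k. *)
Definition iso_hypercube f A k : bool :=
  [exists phi : {ffun k.-tuple bool -> T},
    [&& injectiveb phi, phi @: [set: k.-tuple bool] == A &
        [forall x, forall y, f (phi x) (phi y) == hypercube x y]]].

Definition cube_factor g f : Prop :=
  spanning_subgraph g f /\
  (forall A, A \in components f -> exists k, iso_hypercube f A k).

Definition optimal_cube_factor g f : Prop :=
  cube_factor g f /\
  (forall f', cube_factor g f' -> #|components f| <= #|components f'|).

(* For f an optimal cube factor of G, this is q_k(G). *)
Definition cube_count f k : nat :=
  #|[set A in components f | iso_hypercube f A k]|.

End CubeFactors.

(* The binomial coefficient (p/d choose k), set to 0 when p/d is not an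
   integer. *)
Definition bin_frac (p d k : nat) : nat :=
  if d %| p then 'C(p %/ d, k) else 0.

(* Main.v *)
Require Import Defs.
From mathcomp Require Import all_boot.
From mathcomp Require Import zify.

(* Identify a Fibonacci string with its set of ones, an independent set of the
   path on n vertices.  Hypercubes in the Fibonacci cube are exactly the
   intervals [R, M] of independent sets.  Two maximal independent sets never lie
   in the same interval, and cutting strings into blocks *0 and 010 yields a cube
   factor with one component per maximal independent set.  So the components of
   an optimal cube factor are intervals [R(M), M], one for each maximal M.  In
   any such partition the interval containing A has a top of the largest possible
   size among the independent supersets of A.  Hence the number of A of given size
   lying under tops of given size does not depend on the partition; inverting the
   resulting triangular system, neither does the number of M with |M| = t and
   |R(M)| = r, and it suffices to count the stars in the block factor. *)

Set Implicit Arguments.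
Unset Strict Implicit.
Unset Printing Implicit Defensive.

(** * Interval partitions *)

Section IntervalPartitions.
Variable n : nat.
Implicit Types (A B M N v w : {set 'I_n}) (g R : {set 'I_n} -> {set 'I_n}).

Definition indep A : bool :=
  [forall i in A, forall j in A, (j : nat) != i.+1].

Lemma indepP A :
  reflect (forall i j : 'I_n, i \in A -> j \in A -> (j : nat) <> i.+1) (indep A).
Proof.
apply: (iffP forall_inP) => [h i j iA jA | h i iA].
  by apply/eqP; move/forall_inP: (h i iA); apply.
by apply/forall_inP => j jA; apply/eqP; apply: h.
Qed.

Lemma indepS A B : A \subset B -> indep B -> indep A.
Proof.
move=> /subsetP sAB /indepP iB; apply/indepP => i j /sAB iA /sAB jA.
exact: iB.
Qed.

(** Facets in the sense of the independence complex of the path on [n] vertices. *)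
Definition facet M : bool := maxset indep M.

Lemma facet_indep M : facet M -> indep M.
Proof. by case/maxsetP. Qed.

Lemma facet_max M N : facet M -> indep N -> M \subset N -> N = M.
Proof. by case/maxsetP => _; apply. Qed.

(** Otherwise [i |: M] would be independent, against maximality. *)
Lemma facet_dominates M (i : 'I_n) : facet M -> i \notin M ->
  exists2 j, j \in M & (j : nat) = i.+1 \/ (i : nat) = j.+1.
Proof.
move=> fM iM; have [/exists_inP[j jM /orP h]|/exists_inPn h] :=
  boolP [exists j in M, ((j : nat) == i.+1) || ((i : nat) == j.+1)].
  by exists j => //; case: h => /eqP; [left | right].
case/negP: iM; rewrite -(facet_max fM (N := i |: M)) ?subsetUr ?setU11 //.
apply/indepP => a b /setU1P[->|aM] /setU1P[->|bM]; first by lia.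
- by have := h b bM; rewrite negb_or => /andP[/eqP].
- by have := h a aM; rewrite negb_or => /andP[_ /eqP].
- by move/indepP: (facet_indep fM); apply.
Qed.

(** Here [g v] is the top of the interval through [v], and [R M] the bottom of the interval with top
    [M]. The first clause makes the intervals cover the independent sets, the second makes them
    disjoint. *)
Definition interval_partition g R : Prop :=
  (forall v, indep v -> [/\ facet (g v), R (g v) \subset v & v \subset g v]) /\
  (forall v M, facet M -> R M \subset v -> v \subset M -> g v = M).

Definition splice (j : nat) A B : {set 'I_n} :=
  [set x in A | x <= j] :|: [set x in B | j < x].

Lemma card_splice j A B : #|splice j A B| + #|splice j B A| = #|A| + #|B|.
Proof.
have cU C D : #|splice j C D| = #|[set x in C | x <= j]| + #|[set x in D | j < x]|.
  rewrite cardsU [_ :&: _](_ : _ = set0) ?cards0 ?subn0 //.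
  by apply/setP => x; rewrite !inE; case: leqP; rewrite ?andbF.
have cD (C : {set 'I_n}) : #|C| = #|[set x in C | x <= j]| + #|[set x in C | j < x]|.
  rewrite -cU; congr #|pred_of_set _|; apply/setP => x; rewrite !inE.
  by case: leqP; rewrite ?andbF ?orbF ?andbT.
rewrite !cU (cD A) (cD B); lia.
Qed.

(** The only adjacency that the cut can create is between [j] in [A] and [j.+1] in [B]. *)
Lemma splice_indep j A B : indep A -> indep B ->
  (forall x : 'I_n, x \in A -> x = j :> nat ->
   forall y : 'I_n, y \in B -> y <> j.+1 :> nat) ->
  indep (splice j A B).
Proof.
move=> /indepP iA /indepP iB h; apply/indepP => x y.
rewrite !inE => /orP[] /andP[xA xj] /orP[] /andP[yB yj].
- exact: iA.
- move=> e; apply: (h x xA _ y yB); lia.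
- lia.
- exact: iB.
Qed.

Lemma sub_splice j A B (C : {set 'I_n}) : C \subset A -> C \subset B -> C \subset splice j A B.
Proof.
move=> /subsetP sA /subsetP sB; apply/subsetP => x xC.
by rewrite !inE sA ?sB //; case: leqP.
Qed.

(** * Tops of largest size, and counting by levels, in one partition *)

Section OnePartition.
Variables (g R : {set 'I_n} -> {set 'I_n}).
Hypothesis partg : interval_partition g R.

Lemma part_facet M : facet M -> g M = M.
Proof.
move=> fM; have [fg _ sM] := partg.1 _ (facet_indep fM).
by rewrite (facet_max fM (facet_indep fg)).
Qed.

Lemma part_bot_sub M : facet M -> R M \subset M.
Proof.
by move=> fM; have [_] := partg.1 _ (facet_indep fM); rewrite part_facet.
Qed.

(* Descending induction on A.  Let M = g A and suppose that N is a largest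
   independent superset of A, with |M| < |N|.  By induction every independent
   superset of A meeting M outside A has size at most |M|.  If N minus i were
   also covered by N minus i plus an adjacent k, then M would avoid both i and
   k, and exchanging the parts of M and N beyond the edge {i, k} would produce
   two such sets, so that |M| + |N| <= 2 |M|.  Hence N minus i lies in the
   interval of N for all i in N minus A, which forces A into it too. *)
Lemma part_card_max A N : indep A -> indep N -> A \subset N -> #|N| <= #|g A|.
Proof.
have [m] := ubnP (n - #|A|); elim: m A N => // m IHm A N0 ltm iA iN0 sAN0.
rewrite leqNgt; apply/negP => ltN0.
have IH B N : indep B -> A \proper B -> indep N -> B \subset N -> #|N| <= #|g B|.
  move=> iB pAB iN sBN; apply: IHm => //.
  have := proper_card pAB; have := max_card B; rewrite card_ord.
  by move: ltm; clear; lia.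
have [fM sRA sAM] := partg.1 _ iA; set M := g A in ltN0 fM sRA sAM *.
have iM := facet_indep fM.
pose P N := indep N && (A \subset N).
have PN0 : P N0 by rewrite /P iN0.
case: (@arg_maxnP _ N0 P (fun N => #|N|) PN0) => N /andP[iN sAN] Nmax.
have {N0 iN0 sAN0 PN0 ltN0} ltMN : #|M| < #|N|.
  by apply: leq_trans ltN0 _; apply: Nmax.
(* Since [x |: A] still lies between [R M] and [M], its top is [M], and the induction hypothesis
   applies to it. *)
have small x K : x \in M -> x \notin A -> indep K -> A \subset K -> x \in K ->
    #|K| <= #|M|.
  move=> xM xA iK sAK xK.
  have sxM : x |: A \subset M by rewrite subUset sub1set xM.
  have -> : M = g (x |: A).
    by apply/esym/partg.2 => //; apply: subset_trans sRA (subsetUr _ _).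
  apply: IH => //; first exact: indepS iM.
    by rewrite properUr // sub1set.
  by rewrite subUset sub1set xK.
have disj x K : indep K -> A \subset K -> #|K| = #|N| -> x \in K -> x \notin A ->
    x \notin M.
  move=> iK sAK cK xK xA; apply/negP => xM.
  by have := small x K xM xA iK sAK xK; rewrite cK leqNgt ltMN.
(* The gap of two leaves [A] a proper subset of [N :\ i] below, as the induction hypothesis
   demands. *)
have ltA : #|A|.+1 < #|N|.
  apply: leq_trans (ltMN); rewrite ltnS.
  apply: proper_card; rewrite properE sAM; apply/negP => sMA.
  have eMA : M = A by apply/eqP; rewrite eqEsubset sAM sMA.
  have := facet_max fM iN; rewrite eMA => /(_ sAN) eN.
  by move: ltMN; rewrite eMA eN ltnn.
(* As [M] misses both ends of the edge, it contains [a - 1] and [b + 1]. These lie outside [A],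
   because [A] is contained in independent sets through [a] and through [b]. Cutting [M] and [N]
   between [a] and [b] keeps independence, and each splice contains one of the two points, so
   [small] bounds both. *)
have edge (a b : 'I_n) K K' : (b : nat) = a.+1 -> indep K -> A \subset K ->
    a \in K -> a \notin M -> indep K' -> A \subset K' -> b \in K' -> b \notin M ->
    False.
  move=> eab iK sAK aK aM iK' sAK' bK' bM.
  have [a' a'M [ea|ea]] := facet_dominates fM aM.
    by case/negP: bM; rewrite (_ : b = a') //; apply: val_inj => /=; rewrite ea.
  have [b' b'M [eb|eb]] := facet_dominates fM bM; last first.
    by case/negP: aM; rewrite (_ : a = b') //; apply: val_inj; move: eab eb; clear => /=; lia.
  have a'A : a' \notin A.
    by apply/negP => /(subsetP sAK) h; move/indepP: iK => /(_ _ _ h aK).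
  have b'A : b' \notin A.
    by apply/negP => /(subsetP sAK') h; move/indepP: iK' => /(_ _ _ bK' h).
  have h1 : #|splice a N M| <= #|M|.
    apply: (small b') => //; rewrite ?sub_splice //.
      apply: splice_indep => // x _ _ y yM ey; case/negP: bM.
      by rewrite (_ : b = y) //; apply: val_inj; rewrite /= ey.
    by rewrite !inE b'M eb eab leqW ?orbT.
  have h2 : #|splice a M N| <= #|M|.
    apply: (small a') => //; rewrite ?sub_splice //.
      apply: splice_indep => // x xM ex; case/negP: aM.
      by rewrite (_ : a = x) //; apply: val_inj.
    by rewrite !inE a'M ea leqnSn.
  by have := card_splice a N M; move: h1 h2 ltMN; clear; lia.
have drop1 i : i \in N -> i \notin A -> g (N :\ i) = N.
  move=> iNi iAi.
  have iNi' : indep (N :\ i) by apply: indepS iN; apply: subD1set.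
  have sANi : A \subset N :\ i by rewrite subsetD1 sAN.
  have cNi := cardsD1 i N; rewrite iNi /= in cNi.
  have pA : A \proper N :\ i by rewrite properEcard sANi; move: ltA; rewrite cNi.
  have [fK _ sK] := partg.1 _ iNi'; set K := g _ in fK sK *.
  have iK := facet_indep fK.
  have sAK := subset_trans sANi sK.
  have cK : #|K| = #|N|.
    apply/eqP; rewrite eqn_leq (IH _ N iNi' pA iN (subD1set _ _)) andbT.
    by apply: Nmax; rewrite /P iK.
  apply/eqP; rewrite eq_sym eqEcard cK leqnn andbT; apply/negPn/negP => nNK.
  have iK0 : i \notin K.
    apply: contra nNK => iKi; rewrite -(setD1K iNi) subUset sub1set iKi.
    by apply: sK.
  have [k kK kN] : exists2 k, k \in K & k \notin N.
    apply/subsetPn/negP => sKN; have : K \subset N :\ i by rewrite subsetD1 sKN.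
    by move/subset_leq_card; rewrite cK cNi ltnn.
  have nki : k != i by apply: contraNneq iK0 => <-.
  have kA : k \notin A by apply: contra kN; apply: (subsetP sAN).
  have iM0 := disj _ _ iN sAN erefl iNi iAi.
  have kM := disj _ _ iK sAK cK kK kA.
  (* By the choice of [N], the set [k |: N] is too large to be independent. But [K] contains [k] and
     [N :\ i], so the conflict can only be between [k] and [i], which [edge] excludes. *)
  have : ~~ indep (k |: N).
    apply/negP => ikN; have /Nmax : P (k |: N).
      by rewrite /P ikN (subset_trans sAN) ?subsetUr.
    by rewrite /= cardsU1 kN ltnn.
  case/negP; apply/indepP.
  have iKN x : x \in N -> x != i -> x \in K.
    by move=> xN xi; apply: (subsetP sK); rewrite !inE xi.
  move/indepP: (iK) => iKP.
  move=> a b /setU1P[->|aN] /setU1P[->|bN].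
  - exact: n_Sn.
  - have [->|bi] := eqVneq b i; last by apply: iKP => //; apply: iKN.
    by move=> e; apply: (edge k i K N).
  - have [->|ai] := eqVneq a i; last by apply: iKP => //; apply: iKN.
    by move=> e; apply: (edge i k N K).
  - by move/indepP: iN; apply.
have [i iN1 iA1] : exists2 i, i \in N & i \notin A.
  by apply/subsetPn/negP => /subset_leq_card; rewrite leqNgt ltnW.
have fN : facet N.
  rewrite -(drop1 i iN1 iA1).
  by case: (partg.1 (N :\ i)) => //; apply: indepS iN; apply: subD1set.
have sRN : R N \subset A.
  apply/subsetP => x xR; apply/negPn/negP => xA.
  have xN := subsetP (part_bot_sub fN) _ xR.
  have /partg.1[_] : indep (N :\ x) by apply: indepS iN; apply: subD1set.
  by rewrite drop1 // => /subsetP/(_ _ xR); rewrite !inE eqxx.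
by have eN : M = N := partg.2 _ _ fN sRN sAN; rewrite eN ltnn in ltMN.
Qed.

Lemma card_interval_level A B j : A \subset B ->
  #|[set v : {set 'I_n} | [&& A \subset v, v \subset B & #|v| == #|A| + j]]|
    = 'C(#|B| - #|A|, j).
Proof.
move=> sAB.
have <- : #|B :\: A| = #|B| - #|A| by rewrite cardsD (setIidPr sAB).
rewrite -cards_draws.
have inj : {in [set w : {set 'I_n} | w \subset B :\: A & #|w| == j] &,
    injective (fun w => A :|: w)}.
  move=> w1 w2; rewrite !inE !subsetD => /andP[/andP[_ d1] _] /andP[/andP[_ d2] _] e.
  have h w : [disjoint w & A] -> (A :|: w) :\: A = w.
    by move=> d; rewrite setDUl setDv set0U; apply/setDidPl.
  by rewrite -(h w1) // e h.
rewrite -(card_in_imset inj); congr #|pred_of_set _|; apply/setP => v.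
rewrite inE; apply/and3P/imsetP => [[sA sB /eqP cv] | [w]].
  exists (v :\: A); last by rewrite setDE setUIr setUCr setIT; apply/esym/setUidPr.
  by rewrite inE setSD // cardsD (setIidPr sA) cv addKn eqxx.
rewrite inE subsetD => /andP[/andP[sw dw] /eqP cw] ->.
rewrite subsetUl subUset sAB sw cardsU [A :&: w](_ : _ = set0) ?cards0 ?subn0 ?cw //.
by apply/eqP; rewrite setI_eq0 disjoint_sym.
Qed.

Definition bot_level (t r : nat) : {set {set 'I_n}} :=
  [set M | [&& facet M, #|M| == t & #|R M| == r]].

(** Sort the sets by the size [r] of their bottom, then by their top: each interval from size [r] to
    size [t] contributes its sets of size [j]. *)
Lemma card_level (t j : nat) :
  #|[set v | [&& indep v, #|g v| == t & #|v| == j]]|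
    = \sum_(r < j.+1) #|bot_level t r| * 'C(t - r, j - r).
Proof.
rewrite -sum1_card.
(* [inord] loses nothing here: the bottom is contained in [v], which has size [j]. *)
rewrite (partition_big (fun v => inord #|R (g v)| : 'I_j.+1) predT) //=.
apply: eq_bigr => r _.
rewrite (partition_big g (mem (bot_level t r))) /=; last first.
  move=> v; rewrite !inE => /andP[/and3P[iv gv /eqP cv] /eqP <-].
  have [fg sR sv] := partg.1 _ iv; rewrite fg gv /= inordK //.
  by rewrite ltnS -cv subset_leq_card.
rewrite -sum_nat_const; apply: eq_bigr => M; rewrite !inE.
move=> /and3P[fM /eqP cM /eqP cR].
rewrite -cM -cR -card_interval_level; last exact: part_bot_sub.
rewrite sum1dep_card; congr #|pred_of_set _|; apply/setP => v; rewrite !inE cR.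
rewrite subnKC; last by rewrite -ltnS.
apply/andP/and3P => [[/andP[/and3P[iv _ ->] _] /eqP <-] | [sR sv ->]].
  by have [_ -> ->] := partg.1 _ iv.
rewrite (partg.2 _ _ fM sR sv) eqxx (indepS sv) ?facet_indep //= cM eqxx /=; split=> //.
by apply/eqP/val_inj; rewrite cR /= inordK.
Qed.

End OnePartition.

(** Each top is an independent superset of [v], so [part_card_max] for the other partition bounds
    its size. *)
Lemma part_card_eq g R g' R' v : interval_partition g R ->
  interval_partition g' R' -> indep v -> #|g v| = #|g' v|.
Proof.
move=> pg pg' iv; have [fg _ sg] := pg.1 _ iv; have [fg' _ sg'] := pg'.1 _ iv.
by apply/eqP; rewrite eqn_leq; apply/andP; split;
  [apply: (part_card_max pg') | apply: (part_card_max pg)] => //; apply: facet_indep.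
Qed.

(** The left side of [card_level] is the same for both partitions by [part_card_eq]. The system is
    triangular with unit diagonal: the term [r = j] has coefficient ['C(t - j, 0) = 1]. *)
Lemma bot_level_unique g R g' R' t r : interval_partition g R ->
  interval_partition g' R' -> #|bot_level R t r| = #|bot_level R' t r|.
Proof.
move=> pg pg'; elim/ltn_ind: r => j IH.
have : #|[set v | [&& indep v, #|g v| == t & #|v| == j]]|
     = #|[set v | [&& indep v, #|g' v| == t & #|v| == j]]|.
  congr #|pred_of_set _|; apply/setP => v; rewrite !inE.
  by have [iv|//] := boolP (indep v); rewrite (part_card_eq pg pg' iv).
rewrite (card_level pg) (card_level pg') !big_ord_recr /= subnn bin0 !muln1.
under eq_bigr => r _ do rewrite IH //.
exact: addnI.
Qed.

Definition dim_level R (k : nat) : {set {set 'I_n}} :=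
  [set M | facet M & #|M| - #|R M| == k].

(** Split by the bottom size [r]; the top then has size [r + k]. *)
Lemma dim_level_unique g R g' R' k : interval_partition g R ->
  interval_partition g' R' -> #|dim_level R k| = #|dim_level R' k|.
Proof.
move=> pg pg'.
have cl h S : interval_partition h S ->
    #|dim_level S k| = \sum_(r < n.+1) #|bot_level S (r + k) r|.
  move=> ph; rewrite -sum1_card.
  rewrite (partition_big (fun M => inord #|S M| : 'I_n.+1) predT) //=.
  apply: eq_bigr => r _; rewrite sum1dep_card; congr #|pred_of_set _|.
  have inS M : (inord #|S M| : 'I_n.+1) = #|S M| :> nat.
    by apply: inordK; rewrite ltnS; have := max_card (S M); rewrite card_ord.
  apply/setP => M; rewrite !inE; have [fM|//] := boolP (facet M) => /=.
  rewrite -[inord _ == r]val_eqE /= inS.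
  (* This inequality keeps the subtraction in [dim_level] from being truncated. *)
  have leM := subset_leq_card (part_bot_sub ph fM).
  apply/andP/andP => -[/eqP e1 /eqP e2]; split; apply/eqP => //.
    by rewrite -e1 -e2 subnKC.
  by rewrite e1 e2 addKn.
rewrite (cl _ _ pg) (cl _ _ pg'); apply: eq_bigr => r _.
exact: bot_level_unique pg pg'.
Qed.

End IntervalPartitions.

(** * The block decomposition *)

Notation fib := no_consecutive_ones.

Lemma fib_cons b s : fib (b :: s) -> fib s.
Proof. exact: path_sorted. Qed.

(** A second bit 1 forces zeros on both sides, so a string of length at least 3 begins with [*0] or
    [010]; [*] and [01] are the shortened last blocks. *)
Lemma fib_block_ind (P : seq bool -> Prop) :
  P [::] -> (forall b, P [:: b]) -> P [:: false; true] ->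
  (forall b s, fib s -> P s -> P [:: b, false & s]) ->
  (forall s, fib s -> P s -> P [:: false, true, false & s]) ->
  forall s, fib s -> P s.
Proof.
move=> P0 P1 P01 Pb0 P010 s; have [m] := ubnP (size s).
elim: m s => // m IH [|b [|[] s]] // lts fs.
  case: b lts fs => // lts fs; case: s lts fs => [//|[] s //] lts fs.
  have fs' : fib s by do 3 move/fib_cons: fs => fs.
  by apply: P010 => //; apply: IH => //; rewrite -ltnS; apply: ltnW (ltnW _).
have fs' : fib s by do 2 move/fib_cons: fs => fs.
by apply: Pb0 => //; apply: IH => //; rewrite -ltnS; apply: ltnW.
Qed.

(* Reading a Fibonacci string from the left as a sequence of blocks [*0] and
   [010] (the last block losing its final 0 if necessary), [blocks_top] and
   [blocks_bot] set all the stars to 1 and to 0, and [blocks_dim] counts the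
   stars. *)
Fixpoint blocks_top (s : seq bool) : seq bool :=
  match s with
  | [::] => [::]
  | [:: _] => [:: true]
  | [:: _, false & s'] => [:: true, false & blocks_top s']
  | [:: _; true] => [:: false; true]
  | [:: _, true, _ & s'] => [:: false, true, false & blocks_top s']
  end.

Fixpoint blocks_bot (s : seq bool) : seq bool :=
  match s with
  | [::] => [::]
  | [:: _] => [:: false]
  | [:: _, false & s'] => [:: false, false & blocks_bot s']
  | [:: _; true] => [:: false; true]
  | [:: _, true, _ & s'] => [:: false, true, false & blocks_bot s']
  end.

Fixpoint blocks_dim (s : seq bool) : nat :=
  match s with
  | [::] => 0
  | [:: _] => 1
  | [:: _, false & s'] => (blocks_dim s').+1
  | [:: _; true] => 0
  | [:: _, true, _ & s'] => blocks_dim s'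
  end.

Definition le_bits : seq bool -> seq bool -> bool := all2 implb.

Lemma size_blocks_top s : fib s -> size (blocks_top s) = size s.
Proof. by elim/fib_block_ind => //= [b|] {}s _ ->. Qed.

Lemma size_blocks_bot s : fib s -> size (blocks_bot s) = size s.
Proof. by elim/fib_block_ind => //= [b|] {}s _ ->. Qed.

Lemma fib_blocks_top s : fib s -> fib (blocks_top s).
Proof.
rewrite /fib; elim/fib_block_ind => //= [b|] {}s _ IH;
by case: (blocks_top s) IH.
Qed.

Lemma le_blocks_top s : fib s -> le_bits s (blocks_top s).
Proof.
elim/fib_block_ind => //= [[]|[]] //= {}s _ IH.
Qed.

Lemma le_blocks_bot s : fib s -> le_bits (blocks_bot s) s.
Proof. by elim/fib_block_ind => //= [b|] {}s _ IH; rewrite /le_bits /=. Qed.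

(** Every zero of [blocks_top s] has a neighbouring one in its own block, so no further one can be
    added. *)
Lemma blocks_top_max s v : fib s -> fib v -> le_bits (blocks_top s) v ->
  v = blocks_top s.
Proof.
move=> fs; elim/fib_block_ind: s / fs v => /=.
- by case.
- by move=> _ [|[] []].
- by move=> [|[] [|[] []]].
- move=> b s _ IH [|[] [|[] v]] // fv /= le; congr [:: _, _ & _].
  by apply: IH => //; do 2 move/fib_cons: fv => fv.
- move=> s _ IH [|[] [|[] [|[] v]]] // fv /= le; congr [:: _, _, _ & _].
  by apply: IH => //; do 3 move/fib_cons: fv => fv.
Qed.

Lemma blocks_bot_top s : fib s -> blocks_bot (blocks_top s) = blocks_bot s.
Proof. by elim/fib_block_ind => //= [b|] {}s _ ->. Qed.

(** Between bottom and top only the stars vary. The second bit of a block, which decides its kind,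
    is never a star, so [v] is cut into the same blocks as [s]. *)
Lemma blocks_top_interval s v : fib s ->
  le_bits (blocks_bot s) v -> le_bits v (blocks_top s) ->
  blocks_top v = blocks_top s.
Proof.
move=> fs; elim/fib_block_ind: s / fs v => /=.
- by case.
- by move=> _ [|[] []].
- by move=> [|[] [|[] []]].
- by move=> b s _ IH [|c [|[] v]] //=; case: c => //= l1 l2; rewrite IH.
- by move=> s _ IH [|[] [|[] [|[] v]]] //= l1 l2; rewrite IH.
Qed.

Lemma count_blocks_top s : fib s ->
  count id (blocks_top s) = count id (blocks_bot s) + blocks_dim s.
Proof.
elim/fib_block_ind => //= [b|] {}s _ ->; first by rewrite addnS.
by rewrite addnA.
Qed.

(** The fixed points of [blocks_top] of length [n], generated by their first block; the lengths of
    these lists are Padovan numbers. *)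
Fixpoint block_tops (n : nat) : seq (seq bool) :=
  match n with
  | 0 => [:: [::]]
  | 1 => [:: [:: true]]
  | 2 => [:: [:: true; false]; [:: false; true]]
  | ((n0.+1) as n1).+2 => [seq [:: true, false & s] | s <- block_tops n1] ++
                          [seq [:: false, true, false & s] | s <- block_tops n0]
  end.

Lemma block_tops_ind (P : nat -> Prop) : P 0 -> P 1 -> P 2 ->
  (forall n, P n -> P n.+1 -> P n.+3) -> forall n, P n.
Proof.
move=> P0 P1 P2 P3 n.
suff : [/\ P n, P n.+1 & P n.+2] by case.
by elim: n => // n [? ? ?]; split=> //; apply: P3.
Qed.

Lemma block_tops_fib n s : s \in block_tops n ->
  [/\ size s = n, fib s & blocks_top s = s].
Proof.
elim/block_tops_ind: n s => [s|s|s|n IHn IHn1 s].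
- by rewrite inE => /eqP->.
- by rewrite inE => /eqP->.
- by rewrite !inE => /orP[] /eqP->.
rewrite [block_tops _]/= mem_cat => /orP[] /mapP[u].
  move/IHn1 => [su fu tu] ->; split; rewrite /= ?su ?tu //.
  by move: fu; rewrite /fib; case: (u).
move/IHn => [su fu tu] ->; split; rewrite /= ?su ?tu //.
by move: fu; rewrite /fib; case: (u).
Qed.

Lemma mem_block_tops s : fib s -> blocks_top s = s -> s \in block_tops (size s).
Proof.
elim/fib_block_ind => //=.
- by move=> b [<-].
- move=> b {}s fs IH [<- e].
  (* The empty remainder is separate because the recursion of [block_tops] only starts at length
     3. *)
  case: s fs IH e => [//|c s] fs IH e.
  by rewrite [block_tops _]/= mem_cat; apply/orP; left; apply: map_f; apply: IH.
- move=> {}s fs IH [e]; rewrite mem_cat; apply/orP; right.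
  by apply: map_f; apply: IH.
Qed.

Lemma block_tops_uniq n : uniq (block_tops n).
Proof.
elim/block_tops_ind: n => // n IHn IHn1; rewrite [block_tops _]/= cat_uniq.
rewrite !map_inj_uniq ?IHn ?IHn1 ?andbT //; try by move=> ? ? [].
by apply/hasPn => _ /mapP[s _ ->]; apply/negP => /mapP[].
Qed.

(** Pascal's rule: adding 3 to [p] raises the quotient by one. *)
Lemma bin_frac_rec p k :
  bin_frac (p + 3) 3 k.+1 = bin_frac p 3 k + bin_frac p 3 k.+1.
Proof.
rewrite /bin_frac dvdn_addl // divnDr // divnn addn1.
by case: ifP => // _; rewrite binS addnC.
Qed.

(** Removing a first block [10] leads from [(n.+3, k.+1)] to [(n.+1, k)], removing [010] leads to
    [(n, k.+1)]. Both lower the sum of length and star count by 3, so the recurrence is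
    [bin_frac_rec] for each summand. *)
Lemma count_block_tops n k :
  count (fun s => blocks_dim s == k) (block_tops n)
    = bin_frac (n + k) 3 k + bin_frac (n + k + 1) 3 k.
Proof.
elim/block_tops_ind: n k => [k|k|k|n IHn IHn1 k].
- rewrite /= /bin_frac; case: k => [|[|[|k]]] //=.
  by rewrite !bin_small; [rewrite !if_same | lia | lia].
- rewrite /= /bin_frac; case: k => [|[|[|k]]] //=.
  by rewrite !bin_small; [rewrite !if_same | lia | lia].
- rewrite /= /bin_frac; case: k => [|[|[|k]]] //=.
  by rewrite !bin_small; [rewrite !if_same | lia | lia].
rewrite [block_tops _]/= count_cat !count_map.
rewrite (eq_count (a2 := fun s => (blocks_dim s).+1 == k)) //.
rewrite [X in _ + X](eq_count (a2 := fun s => blocks_dim s == k)) //.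
rewrite IHn; case: k => [|k].
  rewrite (eq_count (a2 := pred0)) // count_pred0 /bin_frac !bin0 add0n !addn0.
  by rewrite -[n.+3]addn3 [n + 3 + 1]addnAC !(@dvdn_addl 3 3).
rewrite (eq_count (a2 := fun s => blocks_dim s == k)) // IHn1.
have -> : n.+3 + k.+1 = (n + k.+1) + 3 by lia.
have -> : n + k.+1 + 3 + 1 = (n + k.+1 + 1) + 3 by lia.
rewrite !bin_frac_rec !addSnnS -!addnA; congr (_ + _); lia.
Qed.

(** * Independent sets as strings *)

Section BitSets.
Variable n : nat.
Implicit Types (A B : {set 'I_n}) (s u : seq bool).

Definition bitset s : {set 'I_n} := [set i : 'I_n | nth false s i].

Definition bits A : n.-tuple bool := [tuple i \in A | i < n].

Lemma nth_bits A (i : 'I_n) : nth false (bits A) i = (i \in A).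
Proof. by rewrite -tnth_nth tnth_mktuple. Qed.

Lemma bitsK A : bitset (bits A) = A.
Proof. by apply/setP => i; rewrite inE nth_bits. Qed.

Lemma bitsetK s : size s = n -> bits (bitset s) = s :> seq bool.
Proof.
move=> ss; apply: (@eq_from_nth _ false); rewrite size_tuple // => i lti.
by rewrite (nth_bits _ (Ordinal lti)) inE.
Qed.

Lemma bitset_tupleK (t : n.-tuple bool) : bits (bitset t) = t.
Proof. by apply: val_inj; apply: bitsetK; rewrite size_tuple. Qed.

Lemma indep_bitset s : size s = n -> indep (bitset s) = fib s.
Proof.
move=> ss; apply/indepP/(sortedP false) => [h i lti | h i j].
  rewrite ss in lti; apply/negP => /andP[si si1].
  by apply: (h (Ordinal (ltnW lti)) (Ordinal lti)); rewrite ?inE.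
rewrite !inE => si sj e; have := h i; rewrite -e si sj ss.
by move/(_ (ltn_ord j)).
Qed.

Lemma indep_bits A : indep A = fib (bits A).
Proof. by rewrite -indep_bitset ?size_tuple // bitsK. Qed.

Lemma le_bits_subset s u : size s = n -> size u = n ->
  le_bits s u = (bitset s \subset bitset u).
Proof.
move=> ss su; rewrite /le_bits all2E ss su eqxx /=.
apply/(all_nthP (false, false))/subsetP => [h i | h i].
  rewrite !inE => si; have := h i; rewrite size_zip ss su minnn.
  by move/(_ (ltn_ord i)); rewrite nth_zip /= ?ss ?su // si.
rewrite size_zip ss su minnn => lti; rewrite nth_zip ?ss ?su //=.
by apply/implyP => si; have := h (Ordinal lti); rewrite !inE; apply.
Qed.

Lemma card_bitset s : size s = n -> #|bitset s| = count id s.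
Proof.
move=> ss; rewrite -sum1_count (big_nth false) ss big_mkord -sum1_card.
by apply: eq_bigl => i; rewrite inE.
Qed.

Definition block_top_set A : {set 'I_n} := bitset (blocks_top (bits A)).
Definition block_bot_set A : {set 'I_n} := bitset (blocks_bot (bits A)).

Lemma size_block_top A : indep A -> size (blocks_top (bits A)) = n.
Proof. by rewrite indep_bits => /size_blocks_top->; rewrite size_tuple. Qed.

Lemma size_block_bot A : indep A -> size (blocks_bot (bits A)) = n.
Proof. by rewrite indep_bits => /size_blocks_bot->; rewrite size_tuple. Qed.

Lemma block_top_set_facet A : indep A -> facet (block_top_set A).
Proof.
move=> iA; have fA := iA; rewrite indep_bits in fA.
apply/maxsetP; split=> [|N iN sN].
  by rewrite indep_bitset ?size_block_top ?fib_blocks_top.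
rewrite -[LHS]bitsK; congr bitset; apply: blocks_top_max => //.
  by rewrite -indep_bits.
by rewrite le_bits_subset ?size_block_top ?size_tuple // bitsK.
Qed.

Lemma sub_block_top_set A : indep A -> A \subset block_top_set A.
Proof.
move=> iA; rewrite -{1}(bitsK A) -le_bits_subset ?size_block_top ?size_tuple //.
by rewrite le_blocks_top // -indep_bits.
Qed.

Lemma facet_blocks_top M : facet M -> blocks_top (bits M) = bits M.
Proof.
move=> fM; have iM := facet_indep fM.
rewrite -[LHS](bitsetK (size_block_top iM)).
by rewrite [bitset _](facet_max fM (facet_indep (block_top_set_facet iM))
  (sub_block_top_set iM)).
Qed.

(** The reference partition: it shows how few components suffice, and its dimensions can be counted.
    Disjointness is [blocks_top_interval]. *)
Lemma block_partition : interval_partition block_top_set block_bot_set.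
Proof.
split=> [v iv | v M fM sR sv].
  split; [exact: block_top_set_facet | | exact: sub_block_top_set].
  have fv := iv; rewrite indep_bits in fv.
  rewrite /block_bot_set /block_top_set bitsetK ?size_block_top //.
  rewrite blocks_bot_top // -{2}(bitsK v).
  by rewrite -le_bits_subset ?size_block_bot ?size_tuple ?le_blocks_bot.
have iM := facet_indep fM; have tM := facet_blocks_top fM.
rewrite /block_top_set (@blocks_top_interval (bits M)) ?tM ?bitsK //.
- by rewrite -indep_bits.
- by rewrite le_bits_subset ?size_block_bot ?size_tuple // bitsK.
- by rewrite le_bits_subset ?size_tuple // !bitsK.
Qed.

(** Facets are exactly the sets of ones of the listed tops, and the dimension of an interval is its
    number of stars by [count_blocks_top]. *)
Lemma card_dim_level_blocks k :
  #|dim_level block_bot_set k| = bin_frac (n + k) 3 k + bin_frac (n + k + 1) 3 k.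
Proof.
rewrite -count_block_tops -size_filter.
set r := filter _ _; rewrite -(size_map bitset).
have inj : {in r &, injective bitset}.
  move=> s u; rewrite !mem_filter => /andP[_ /block_tops_fib[ss _ _]].
  by move=> /andP[_ /block_tops_fib[su _ _]] e; rewrite -(bitsetK ss) e bitsetK.
have /card_uniqP <- : uniq (map bitset r).
  by rewrite map_inj_in_uniq // filter_uniq // block_tops_uniq.
apply: eq_card => M; rewrite inE; apply/andP/mapP => [[fM dM]|[s]].
  exists (bits M : seq bool); last by rewrite bitsK.
  have fb : fib (bits M) by rewrite -indep_bits facet_indep.
  have tM := facet_blocks_top fM.
  have := mem_block_tops fb tM; rewrite size_tuple mem_filter => ->; rewrite andbT.
  rewrite -(eqP dM) -{2}(bitsK M) /block_bot_set !card_bitset ?size_tuple //.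
    by rewrite -{2}tM count_blocks_top // addKn.
  by rewrite size_block_bot // facet_indep.
rewrite mem_filter => /andP[ds /block_tops_fib[ss fs ts]] ->.
have bs : bits (bitset s) = s :> seq bool by rewrite bitsetK.
have is_s : indep (bitset s) by rewrite indep_bitset.
split; first by have := block_top_set_facet is_s; rewrite /block_top_set bs ts.
rewrite /block_bot_set bs !card_bitset ?size_blocks_bot //.
by rewrite -{1}ts count_blocks_top // addKn.
Qed.

End BitSets.

(** * Hypercubes inside hypercubes *)

Section SymmetricDifference.
Variable T : finType.
Implicit Types A B C : {set T}.

Definition symdiff A B : {set T} := [set x | (x \in A) (+) (x \in B)].

Lemma symdiffA : associative symdiff.
Proof. by move=> A B C; apply/setP => x; rewrite !inE addbA. Qed.

Lemma symdiffC : commutative symdiff.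
Proof. by move=> A B; apply/setP => x; rewrite !inE addbC. Qed.

Lemma symdiffK A B : symdiff A (symdiff A B) = B.
Proof. by apply/setP => x; rewrite !inE addKb. Qed.

Lemma symdiff_eq0 A B : symdiff A B = set0 -> A = B.
Proof.
by move/setP=> h; apply/setP => x; have := h x; rewrite !inE; do 2 case: (x \in _).
Qed.

Lemma symdiff_inj A : injective (symdiff A).
Proof. exact: can_inj (symdiffK A). Qed.

Lemma symdiffD1 A x : x \in A -> symdiff A (A :\ x) = [set x].
Proof.
move=> xA; apply/setP => y; rewrite !inE.
by have [->|] := eqVneq y x; rewrite ?xA //= addbb.
Qed.

End SymmetricDifference.

(* Opposite edges of a 4-cycle of a hypercube have the same direction, hence a
   copy of Q_k is determined by one vertex and the directions of the k edges at
   that vertex. *)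
Lemma cube_image (k n : nat) (psi : {set 'I_k} -> {set 'I_n}) :
  injective psi ->
  (forall A B, #|symdiff A B| = 1 -> #|symdiff (psi A) (psi B)| = 1) ->
  exists R M : {set 'I_n}, [/\ R \subset M, #|M| = #|R| + k &
    forall v : {set 'I_n}, (exists A, psi A = v) <-> (R \subset v) && (v \subset M)].
Proof.
move=> injpsi adj; pose a := psi set0.
(* [c i] is the direction of the image of the [i]-th edge at the base vertex [a]. *)
have /fin_all_exists[c cP] : forall i, exists x, symdiff a (psi [set i]) = [set x].
  move=> i; apply/cards1P/eqP; apply: adj.
  rewrite (_ : symdiff _ _ = [set i]) ?cards1 //.
  by apply/setP => x; rewrite !inE.
have injc : injective c.
  move=> i j e; apply/set1P; rewrite -(injpsi [set i] [set j]) ?set11 //.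
  by apply: (@symdiff_inj _ a); rewrite !cP e.
have imD1 (A : {set 'I_k}) x : x \in A -> c @: (A :\ x) = symdiff (c @: A) [set c x].
  move=> xA; rewrite -{2}(setD1K xA) imsetU1; apply/setP => z; rewrite !inE.
  by have [->|] := eqVneq z (c x); rewrite /= ?addbF // mem_imset // !inE eqxx.
have psiE A : symdiff a (psi A) = c @: A.
  have [m] := ubnP #|A|; elim: m A => // m IH A ltA.
  have [->|[i iA]] := set_0Vmem A.
    by rewrite imset0; apply/setP => x; rewrite !inE addbb.
  have [A1|[j jAi]] := set_0Vmem (A :\ i).
    by rewrite -(setD1K iA) A1 setU0 cP imset_set1.
  have /andP[ji jA] : (j != i) && (j \in A) by rewrite !inE in jAi.
  have IHD x : x \in A -> symdiff a (psi (A :\ x)) = symdiff (c @: A) [set c x].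
    by move=> xA; rewrite -imD1 // IH //; rewrite (cardsD1 x) xA in ltA.
  (* The left side is the error in the claim for [A]. As [psi A] is adjacent to [psi (A :\ x)],
     which is already known, the error is a difference of two singletons, one of them [c x]. *)
  have flip x : x \in A -> exists y,
      symdiff (symdiff a (psi A)) (c @: A) = symdiff [set c x] [set y].
    move=> xA; have /eqP/cards1P[y ey] : #|symdiff (psi A) (psi (A :\ x))| = 1.
      by apply: adj; rewrite symdiffD1 ?cards1.
    exists y; apply/setP => z; move/setP/(_ z): ey; move/setP/(_ z): (IHD x xA).
    rewrite !inE; case: (z \in a); case: (z \in psi A); case: (z \in psi _);
    by case: (z \in _ @: _); case: (z == c x) => //= _ <-.
  have [p ep] := flip i iA; have [q eq] := flip j jA.
  apply: symdiff_eq0; rewrite ep; apply/setP => z; rewrite !inE.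
  have [->|nip] := eqVneq (c i) p; first by rewrite addbb.
  have eqi : q = c i.
    have : c i \in symdiff [set c j] [set q].
      by rewrite -eq ep !inE eqxx (negbTE nip).
    by rewrite !inE (inj_eq injc) eq_sym (negbTE ji) => /eqP.
  (* A nonzero error can only be [c i] together with [c j], so [psi A] would coincide with the image
     two levels down, against injectivity. *)
  have : psi A = psi (A :\ i :\ j).
    apply: (@symdiff_inj _ a); rewrite [RHS]IH; last first.
      rewrite (cardsD1 i) iA (cardsD1 j) jAi !add1n in ltA.
      exact: ltnW.
    rewrite imD1 // imD1 //; apply: symdiff_eq0; rewrite -symdiffA.
    apply/setP => y; move/setP/(_ y): eq; rewrite eqi !inE.
    case: (y \in a); case: (y \in psi A); case: (y \in _ @: _);
    by case: (y == c i); case: (y == c j).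
  by move/injpsi/setP/(_ j); rewrite !inE eqxx jA.
(* The image consists of the sets differing from [a] only inside [D], which form an interval. *)
pose D := c @: setT; exists (a :\: D), (a :|: D); split.
- by rewrite subDset subsetU // subsetUl orbT.
- have -> : a :|: D = (a :\: D) :|: D.
    by apply/setP => x; rewrite !inE; case: (x \in D); rewrite ?orbT ?orbF.
  rewrite cardsU [_ :&: _](_ : _ = set0); last first.
    by apply/setP => x; rewrite !inE; case: (x \in D); rewrite ?andbF.
  by rewrite cards0 subn0 card_imset // cardsT card_ord.
move=> v; split=> [[A <-]|/andP[/subsetP sR /subsetP sM]].
  have hA x : x \in symdiff a (psi A) -> x \in D.
    by rewrite psiE => /imsetP[i _ ->]; apply: imset_f.
  apply/andP; split; apply/subsetP => x; have := hA x; rewrite !inE;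
  by case: (x \in a); case: (x \in psi A); case: (x \in D) => // ->.
exists (c @^-1: symdiff a v); apply: (@symdiff_inj _ a); rewrite psiE.
apply/setP => x; apply/imsetP/idP => [[i] | xv]; first by rewrite inE => ? ->.
have : x \in D.
  have := sR x; have := sM x; move: xv; rewrite !inE.
  by case: (x \in a); case: (x \in v); case: (x \in D) => //= _ h1 h2;
    rewrite ?h1 ?h2.
by case/imsetP => i _ ex; exists i => //; rewrite inE -ex.
Qed.

(** * Cube factors *)

Lemma differ_onceE n (x y : n.-tuple bool) :
  differ_once x y = (#|symdiff (bitset n x) (bitset n y)| == 1).
Proof.
rewrite /differ_once; congr (_ == _); apply: eq_card => i.
by rewrite !inE -!tnth_nth; do 2 case: (tnth _ _).
Qed.

Section FibonacciCube.
Variable n : nat.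
Implicit Types (x y : fib_string n) (f : rel (fib_string n)) (A M v : {set 'I_n}).

Definition supp x : {set 'I_n} := bitset n (val x).

Lemma indep_supp x : indep (supp x).
Proof. by rewrite indep_bitset ?size_tuple //; case: x. Qed.

Lemma fib_bits0 : fib (bits (set0 : {set 'I_n})).
Proof. by rewrite -indep_bits; apply/indepP => i j; rewrite inE. Qed.

(** A total inverse of [supp]; a set that is not independent goes to the zero string. *)
Definition of_set A : fib_string n :=
  insubd (Sub (bits set0) fib_bits0 : fib_string n) (bits A).

Lemma of_setK A : indep A -> supp (of_set A) = A.
Proof.
by move=> iA; rewrite /supp /of_set insubdK ?bitsK // unfold_in -indep_bits.
Qed.

Lemma supp_inj : injective supp.
Proof.
move=> x y e; apply: val_inj; rewrite -[val x]bitset_tupleK -[val y]bitset_tupleK.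
by congr bits.
Qed.

Lemma suppK x : of_set (supp x) = x.
Proof. by apply: supp_inj; rewrite of_setK ?indep_supp. Qed.

Lemma fib_cubeE x y : fib_cube x y = (#|symdiff (supp x) (supp y)| == 1).
Proof. exact: differ_onceE. Qed.

Definition cube_top (C : {set fib_string n}) : {set 'I_n} := \bigcup_(y in C) supp y.
Definition cube_bot (C : {set fib_string n}) : {set 'I_n} := \bigcap_(y in C) supp y.

(** [cube_image] makes [C] an interval. Its two ends are supports of vertices of [C], so the union
    and the intersection attain them and the top is independent. *)
Lemma iso_hypercube_interval f C k : subrel f (@fib_cube n) ->
  iso_hypercube f C k ->
  [/\ indep (cube_top C), #|cube_top C| - #|cube_bot C| = k &
      forall y, (y \in C) = (cube_bot C \subset supp y) && (supp y \subset cube_top C)].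
Proof.
move=> sf /existsP[phi /and3P[/injectiveP injphi /eqP imphi /forallP adj]].
pose psi (A : {set 'I_k}) := supp (phi (bits A)).
have injpsi : injective psi.
  by move=> A B /supp_inj/injphi e; rewrite -(bitsK A) e bitsK.
have adjpsi (A B : {set 'I_k}) : #|symdiff A B| = 1 -> #|symdiff (psi A) (psi B)| = 1.
  move=> cAB; apply/eqP; rewrite -fib_cubeE; apply: sf.
  move/forallP: (adj (bits A)) => /(_ (bits B))/eqP->.
  by rewrite /hypercube differ_onceE !bitsK cAB.
have [R [M [sRM cM inC]]] := cube_image injpsi adjpsi.
have memC y : (y \in C) = (R \subset supp y) && (supp y \subset M).
  rewrite -imphi; apply/imsetP/idP => [[t _ ->]|].
    by apply/inC; exists (bitset k t); rewrite /psi bitset_tupleK.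
  by case/inC => A /supp_inj <-; exists (bits A).
have inM A : R \subset A -> A \subset M -> exists2 y, y \in C & supp y = A.
  move=> sR sA; have /inC[B eB] : (R \subset A) && (A \subset M) by rewrite sR.
  by exists (phi (bits B)); rewrite ?memC -/(psi B) eB ?sR.
have [yM yMC eM] := inM M sRM (subxx _).
have [yR yRC eR] := inM R (subxx _) sRM.
have -> : cube_top C = M.
  apply/eqP; rewrite eqEsubset -{2}eM (bigcup_sup yM) // andbT.
  by apply/bigcupsP => y; rewrite memC => /andP[].
have -> : cube_bot C = R.
  apply/eqP; rewrite eqEsubset -{1}eR (bigcap_inf yR) //=.
  by apply/bigcapsP => y; rewrite memC => /andP[].
by split=> //; [rewrite -eM indep_supp | rewrite cM addKn].
Qed.

(** * From an interval partition to a cube factor *)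

Section FactorOfPartition.
Variables g R : {set 'I_n} -> {set 'I_n}.
Hypothesis partg : interval_partition g R.

Definition part_factor : rel (fib_string n) :=
  fun x y => fib_cube x y && (g (supp x) == g (supp y)).

Lemma part_factor_sym : symmetric part_factor.
Proof. by move=> x y; rewrite /part_factor !fib_cubeE symdiffC [g _ == _]eq_sym. Qed.

(** Adding the missing elements of the top one at a time never leaves the interval. *)
Lemma connect_part_top x : connect part_factor x (of_set (g (supp x))).
Proof.
have [m] := ubnP #|g (supp x) :\: supp x|; elim: m x => // m IH x ltm.
have [fg sR sg] := partg.1 _ (indep_supp x).
have [e0|[i]] := set_0Vmem (g (supp x) :\: supp x).
  have -> : g (supp x) = supp x.
    by apply/eqP; rewrite eqEsubset sg -setD_eq0 e0 eqxx.
  by rewrite suppK.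
rewrite inE => /andP[ix ig].
have sU : i |: supp x \subset g (supp x) by rewrite subUset sub1set ig.
have sy : supp (of_set (i |: supp x)) = i |: supp x.
  by rewrite of_setK // (indepS sU) ?facet_indep.
have gy : g (supp (of_set (i |: supp x))) = g (supp x).
  by rewrite sy; apply: partg.2 => //; apply: subset_trans sR (subsetUr _ _).
apply: (@connect_trans _ _ (of_set (i |: supp x))).
  apply: connect1; rewrite /part_factor gy eqxx fib_cubeE sy symdiffC andbT.
  rewrite -{2}(setU1K ix) symdiffD1 ?cards1 // !inE eqxx //.
rewrite -gy; apply: IH; rewrite gy sy.
rewrite (cardsD1 i) in_setD ix ig /= in ltm.
by rewrite setUC -setDDl.
Qed.

Lemma connect_part_factor x y :
  connect part_factor x y = (g (supp x) == g (supp y)).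
Proof.
apply/idP/eqP => [|e].
  pose a := [pred z | g (supp z) == g (supp x)].
  have cl : closed part_factor a.
    by move=> u v /andP[_ /eqP e]; rewrite !inE e.
  by move/(closed_connect cl); rewrite !inE eqxx => /esym/eqP.
apply: connect_trans (connect_part_top x) _.
rewrite (sym_connect_sym part_factor_sym) e; exact: connect_part_top.
Qed.

Lemma part_factor_cube_factor : cube_factor (@fib_cube n) part_factor.
Proof.
split; first by split; [exact: part_factor_sym | move=> x y /andP[]].
move=> _ /imsetP[x _ ->].
have [fM sR sM] := partg.1 _ (indep_supp x); set M := g (supp x) in fM sR sM *.
have sRM := part_bot_sub partg fM.
(* [D] holds the free positions of the interval; adding subsets of [D] to [R M] parametrises it as a
   cube of dimension [#|D|]. *)
pose D := M :\: R M; pose e (i : 'I_#|D|) : 'I_n := enum_val i.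
have inje : injective e by apply: enum_val_inj.
pose psi (B : {set 'I_#|D|}) := R M :|: e @: B.
have sRpsi B : R M \subset psi B by apply: subsetUl.
have eD i : e i \in D by apply: enum_valP.
have spsi B : psi B \subset M.
  rewrite subUset sRM; apply/subsetP => _ /imsetP[i _ ->].
  by have := eD i; rewrite inE => /andP[].
have suppsi B : supp (of_set (psi B)) = psi B.
  by rewrite of_setK // (indepS (spsi B)) ?facet_indep.
have gpsi B : g (psi B) = M by apply: partg.2.
have sdpsi B1 B2 : symdiff (psi B1) (psi B2) = e @: symdiff B1 B2.
  apply/setP => z; rewrite !inE; have [zD|zD] := boolP (z \in D); last first.
    have h B : z \in e @: B = false.
      by apply/negP => /imsetP[i _ ez]; case/negP: zD; rewrite ez.
    by rewrite !h addbb.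
  have -> : z = e (enum_rank_in zD z) by rewrite /e enum_rankK_in.
  rewrite !mem_imset // inE.
  by have := eD (enum_rank_in zD z); rewrite inE => /andP[/negbTE->].
exists #|D|; apply/existsP.
exists [ffun t : #|D|.-tuple bool => of_set (psi (bitset #|D| t))].
have f0E (t1 t2 : #|D|.-tuple bool) : part_factor (of_set (psi (bitset #|D| t1)))
    (of_set (psi (bitset #|D| t2))) = hypercube t1 t2.
  rewrite /part_factor fib_cubeE !suppsi !gpsi eqxx andbT sdpsi card_imset //.
  by rewrite /hypercube differ_onceE.
apply/and3P; split.
- apply/injectiveP => t1 t2; rewrite !ffunE => /(congr1 supp); rewrite !suppsi => e12.
  have : e @: symdiff (bitset #|D| t1) (bitset #|D| t2) = set0.
    by rewrite -sdpsi e12; apply/setP => z; rewrite !inE addbb.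
  move/eqP; rewrite imset_eq0 => /eqP/symdiff_eq0 => h.
  by rewrite -(bitset_tupleK t1) h bitset_tupleK.
- apply/eqP/setP => y; rewrite inE connect_part_factor -/M.
  apply/imsetP/eqP => [[t _ ->]|eM].
    by rewrite ffunE suppsi gpsi.
  have [_] := partg.1 _ (indep_supp y); rewrite -eM => sRy sy.
  exists (bits (e @^-1: supp y)) => //; rewrite ffunE bitsK -[LHS]suppK.
  congr of_set; apply/setP => z; rewrite [RHS]in_setU.
  have [zR|zR] := boolP (z \in R M); first by rewrite (subsetP sRy).
  apply/idP/imsetP => [zy|[i]]; last by rewrite inE => ? ->.
  have zD : z \in D by rewrite inE zR (subsetP sy).
  have ez : e (enum_rank_in zD z) = z by rewrite /e enum_rankK_in.
  by exists (enum_rank_in zD z); rewrite ?ez // inE ez.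
- apply/forallP => t1; apply/forallP => t2; apply/eqP; rewrite !ffunE; exact: f0E.
Qed.

Lemma card_components_part_factor :
  #|components part_factor| <= #|[set M : {set 'I_n} | facet M]|.
Proof.
pose h M := [set y | M == g (supp y)].
apply: leq_trans (leq_imset_card h _); apply: subset_leq_card.
apply/subsetP => _ /imsetP[x _ ->]; apply/imsetP; exists (g (supp x)).
  by rewrite inE; case: (partg.1 _ (indep_supp x)).
by apply/setP => y; rewrite !inE connect_part_factor.
Qed.

End FactorOfPartition.

(** * From an optimal cube factor to an interval partition *)

Section PartitionOfFactor.
Variable f : rel (fib_string n).
Hypothesis optf : optimal_cube_factor (@fib_cube n) f.

Let comp x : {set fib_string n} := [set y | connect f x y].
Let F : {set {set 'I_n}} := [set M | facet M].

Let sub_f : subrel f (@fib_cube n).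
Proof. by case: optf => -[[]]. Qed.

Let sym_f : connect_sym f.
Proof. by apply: sym_connect_sym; case: optf => -[[]]. Qed.

Let comp_in x : comp x \in components f.
Proof. exact: imset_f. Qed.

Let self x : x \in comp x.
Proof. by rewrite inE connect0. Qed.

Let comp_eq x y : y \in comp x -> comp y = comp x.
Proof.
rewrite inE => xy; apply/setP => z; rewrite !inE.
by rewrite (same_connect sym_f xy).
Qed.

Let comp_iso x : exists k, iso_hypercube f (comp x) k.
Proof. by case: optf => -[_ h] _; apply: h. Qed.

Let comp_top_indep x : indep (cube_top (comp x)).
Proof. by have [k /(iso_hypercube_interval sub_f)[]] := comp_iso x. Qed.

Let mem_comp x y :
  (y \in comp x) = (cube_bot (comp x) \subset supp y) && (supp y \subset cube_top (comp x)).
Proof. by have [k /(iso_hypercube_interval sub_f)[]] := comp_iso x. Qed.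

Let comp_facet M : facet M -> cube_top (comp (of_set M)) = M.
Proof.
move=> fM; apply: facet_max => //.
by have := self (of_set M); rewrite mem_comp of_setK ?facet_indep // => /andP[].
Qed.

(** Every facet is the top of its own component, so there are at least as many components as facets.
    Optimality against the block factor gives the converse inequality, hence [cube_top] is a
    bijection from components to facets. *)
Let facets_eq :
  F = cube_top @: components f /\ {in components f &, injective cube_top}.
Proof.
have sF : F \subset cube_top @: components f.
  apply/subsetP => M; rewrite inE => fM; apply/imsetP.
  by exists (comp (of_set M)); rewrite ?comp_facet.
have leF : #|components f| <= #|F|.
  apply: leq_trans (card_components_part_factor (block_partition n)).
  by apply: optf.2; apply: part_factor_cube_factor; apply: block_partition.
have le1 := leq_imset_card cube_top (components f).
have le2 := subset_leq_card sF.
split; first by apply/eqP; rewrite eqEcard sF (leq_trans le1).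
by apply/imset_injP; rewrite eqn_leq le1 (leq_trans leF).
Qed.

Let top_facet x : facet (cube_top (comp x)).
Proof.
have [eF _] := facets_eq; have : cube_top (comp x) \in F by rewrite eF imset_f.
by rewrite inE.
Qed.

Let comp_top x : comp (of_set (cube_top (comp x))) = comp x.
Proof.
apply: comp_eq; rewrite mem_comp of_setK // subxx andbT.
by have := self x; rewrite mem_comp => /andP[]; apply: subset_trans.
Qed.

Definition factor_top v : {set 'I_n} := cube_top (comp (of_set v)).
Definition factor_bot v : {set 'I_n} := cube_bot (comp (of_set v)).

Lemma factor_partition : interval_partition factor_top factor_bot.
Proof.
split=> [v iv | v M fM sR sv].
  have := self (of_set v); rewrite mem_comp of_setK // => /andP[s1 s2].
  split=> //; first exact: top_facet.
  by rewrite /factor_bot /factor_top comp_top.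
have iv := indepS sv (facet_indep fM).
rewrite /factor_top (@comp_eq (of_set M)) ?comp_facet //.
by rewrite mem_comp of_setK // comp_facet // sv andbT.
Qed.

Lemma cube_count_dim_level k : cube_count f k = #|dim_level factor_bot k|.
Proof.
rewrite /cube_count -(card_in_imset (f := cube_top)); last first.
  by move=> C C'; rewrite !inE => /andP[h _] /andP[h' _]; apply: facets_eq.2.
apply: eq_card => M; rewrite inE; apply/imsetP/andP => [[C]|[fM /eqP dM]].
  rewrite inE => /andP[/imsetP[x _ ->] iso] ->; split; first exact: top_facet.
  rewrite /factor_bot comp_top; apply/eqP.
  by case: (iso_hypercube_interval sub_f iso).
exists (comp (of_set M)); last by rewrite comp_facet.
rewrite inE comp_in; have [k' iso] := comp_iso (of_set M).
(* The sizes of the two ends determine the dimension, so [k'] is [k]. *)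
have [_ + _] := iso_hypercube_interval sub_f iso.
by rewrite comp_facet // dM => ->.
Qed.

End PartitionOfFactor.
End FibonacciCube.

(** The partition coming from [f] has as many intervals of dimension [k] as the block partition,
    where they are counted. *)
Lemma cube_count_fib_cube n (f : rel (fib_string n)) k :
  optimal_cube_factor (@fib_cube n) f ->
  cube_count f k = bin_frac (n + k) 3 k + bin_frac (n + k + 1) 3 k.
Proof.
move=> optf; rewrite cube_count_dim_level // -card_dim_level_blocks.
exact: dim_level_unique (factor_partition optf) (block_partition n).
Qed.

Theorem theorem2p7 (n k : nat) (f : rel (fib_string n))
    (optf : optimal_cube_factor (@fib_cube n) f) :
  [/\ cube_count f k = bin_frac (n + k) 3 k + bin_frac (n + k + 1) 3 k,
      forall m : nat, n + k = 3 * m \/ n + k + 1 = 3 * m ->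
        cube_count f k = 'C(m, k)
    & forall m : nat, n + k = 3 * m + 1 -> cube_count f k = 0].
Proof.
have count_f := cube_count_fib_cube k optf.
rewrite count_f; split=> // m; rewrite /bin_frac.
  (* Of [n + k] and [n + k + 1] only one is divisible by 3, so a single binomial survives. *)
  case=> e.
    by rewrite e dvdn_mulr // mulKn // dvdn_addr ?dvdn_mulr //= addn0.
  rewrite e dvdn_mulr // mulKn //.
  by have /negbTE-> : ~~ (3 %| n + k) by lia.
by move=> ->; rewrite -addnA !(dvdn_addr _ (dvdn_mulr m (dvdnn 3))).
Qed.
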